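(* Let $\mathcal{F}$ be a commutative perfect semi-field of characteristic $1$ (satisfying the standing assumptions in the context) which is complete for an F-norm $\|\cdot\|$. Let $\sim$ be a maximal congruence on $\mathcal{F}$, with projection $\pi:\mathcal{F}\to\mathcal{F}/\sim$. Then $\mathcal{F}/\sim\;=\{t\,\pi(E)\,:\,t\in\mathbb{R}\}$, and the map $t\,\pi(E)\mapsto t$ defines an isomorphism of semi-fields from $(\mathcal{F}/\sim,\oplus,+)$ onto $(\mathbb{R},\max(\,,),+)$.
   Context: A commutative perfect semi-field of characteristic $1$ is a triple $(\mathcal{F},\oplus,+)$ where: $\oplus$ is a commutative associative law with $X\oplus X=X$ for all $X$; $(\mathcal{F},+)$ is an abelian group with identity $0$ and $X+(Y\oplus Z)=(X+Y)\oplus(X+Z)$ for all $X,Y,Z$; for every integer $n\ge 1$ the map $X\mapsto nX$ is surjective (it is then bijective, and $(\mathcal F,+)$ is naturally a $\mathbb{Q}$-vector space). Partial order: $X\le Y$ iff $X\oplus Y=Y$. Standing assumptions: $\mathcal{F}\neq\{0\}$; there is a fixed $E\in\mathcal{F}$ such that for every $X\in\mathcal{F}$ there is $t\in\mathbb{Q}^+$ (non-negative rationals) with $-tE\le X\le tE$; $r(X)\in\mathbb{R}^+$ denotes the infimum of all such $t$; and $r(X)=0$ if and only if $X=0$. An F-norm on $\mathcal{F}$ is a map $\|\cdot\|:\mathcal{F}\to\mathbb{R}^+$ such that for all $t\in\mathbb{Q}$ and $X,Y,X',Y'\in\mathcal{F}$: $\|tX\|=|t|\,\|X\|$, $\|X+Y\|\le\|X\|+\|Y\|$,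 $r(X)\le\|X\|$, and $\|X\oplus Y-X'\oplus Y'\|\le\max(\|X-X'\|,\|Y-Y'\|)$. Complete means complete for the distance $\|X-Y\|$. In that case the $\mathbb{Q}$-vector space structure of $\mathcal{F}$ extends by continuity to an $\mathbb{R}$-vector space structure ($tX=\lim r_nX$ for rationals $r_n\to t$). A congruence on $\mathcal{F}$ is an equivalence relation $\sim$ such that $X\sim Y$ implies $-X\sim -Y$, $X+Z\sim Y+Z$ and $X\oplus Z\sim Y\oplus Z$ for all $Z$; the quotient $\mathcal{F}/\sim$ carries the induced laws $\oplus,+$. The trivial congruence is the one for which $X\sim Y$ for all $X,Y$. Write $\sim_1\le\sim_2$ if $X\sim_1Y$ implies $X\sim_2Y$. A congruence $\sim$ is maximal if it is not trivial and $\sim\,\le\,\sim'$ (with $\sim'$ a congruence) implies that $\sim'=\sim$ or that $\sim'$ is trivial. Maximal congruences are closed in $\mathcal F\times\mathcal F$, hence the class $\pi(0)$ is a real vector subspace and $\mathcal{F}/\sim\,=\mathcal{F}/\pi(0)$ is a real vector space with $t\,\pi(X)=\pi(tX)$. *)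

(* Defs.v *)
From HB Require Import structures.
From mathcomp Require Import all_boot all_order all_algebra.
From mathcomp Require Import all_classical all_reals all_analysis.

Set Implicit Arguments.
Unset Strict Implicit.
Unset Printing Implicit Defensive.

Import Order.TTheory GRing.Theory Num.Theory.
Import numFieldNormedType.Exports.

Local Open Scope classical_set_scope.
Local Open Scope quotient_scope.
Local Open Scope ring_scope.

(* The group law of the semi-field, which plays the role of the product, is
   written additively: it is the law of the underlying zmodType. *)
HB.mixin Record isPerfectSemifield1 F of GRing.Zmodule F := {
  oplus : F -> F -> F;
  oplusA : associative oplus;
  oplusC : commutative oplus;
  oplusxx : idempotent_op oplus;
  addr_oplusr : right_distributive +%R oplus;
  mulrn_surj : forall n, (0 < n)%N -> forall X : F, exists Y : F, Y *+ n = X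
}.

#[short(type="perfectSemifield1Type")]
HB.structure Definition PerfectSemifield1 :=
  { F of isPerfectSemifield1 F & GRing.Zmodule F }.

Notation "X ⊕ Y" := (oplus X Y) (at level 50, left associativity) : ring_scope.

Definition semifield_iso (F G : perfectSemifield1Type) (f : F -> G) : Prop :=
  [/\ bijective f, {morph f : X Y / X ⊕ Y} & {morph f : X Y / X + Y}].

Section Scaling.
Context {F : perfectSemifield1Type}.
Implicit Types (X Y Z : F) (s t : rat) (n : nat).

Definition sle X Y : Prop := X ⊕ Y = Y.

(* The rational multiple (p / q) X is the Y such that q Y = p X; existence and
   uniqueness are given by qscaleP and qscale_uniq below. *)
Definition qscale t X : F :=
  xget 0 [set Y : F | Y *~ denq t = X *~ numq t].

Lemma addr_oplusl : left_distributive +%R (@oplus F).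
Proof. by move=> X Y Z; rewrite addrC addr_oplusr ![Z + _]addrC. Qed.

Lemma mulrn_eq0_torsion n X : (0 < n)%N -> X *+ n = 0 -> X = 0.
Proof.
case: n => // n _ nX0.
pose S := fix S k := if k is k'.+1 then S k' ⊕ X *+ k else (0 : F).
have SS k : S k.+1 = S k ⊕ X *+ k.+1 by [].
have SX k : 0 ⊕ (S k + X) = S k.+1.
  elim: k => [|k IH]; first by rewrite SS add0r mulr1n.
  by rewrite [in LHS]SS addr_oplusl oplusA IH -mulrSr.
have S0 k : S k ⊕ 0 = S k.
  by elim: k => [|k IH]; rewrite ?oplusxx // SS -oplusA (oplusC _ 0) oplusA IH.
have SnX0 : 0 ⊕ (S n + X) = S n + X.
  case: n nX0 {SX} => [|k] nX0; first by rewrite add0r -[X]mulr1n nX0 oplusxx.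
  by rewrite SS addr_oplusl -mulrSr nX0 oplusC -oplusA oplusxx.
by apply: (addrI (S n)); rewrite addr0 -SnX0 SX SS nX0 S0.
Qed.

Lemma mulrz_inj (d : int) : d != 0 -> injective (fun X => X *~ d).
Proof.
move=> d0 X Y /= e; apply/eqP; rewrite -subr_eq0; apply/eqP.
have {e} : (X - Y) *~ d = 0 by rewrite mulrzBl e subrr.
case: d d0 => [[|n] // _ /mulrn_eq0_torsion -> //|n _].
by rewrite NegzE mulrNz => /eqP; rewrite oppr_eq0 => /eqP /mulrn_eq0_torsion ->.
Qed.

Lemma qscaleP t X : qscale t X *~ denq t = X *~ numq t.
Proof.
rewrite /qscale; case: xgetP => [Y -> //|noY]; exfalso.
have [n dE] : exists n, denq t = n.+1%:Z.
  by case: (denq t) (denq_gt0 t) => [[|n]|n] // _; exists n.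
have [Y YE] := @mulrn_surj F n.+1 isT (X *~ numq t).
by apply: (noY Y); rewrite /= dE.
Qed.

Lemma qscale_uniq t X Y : Y *~ denq t = X *~ numq t -> qscale t X = Y.
Proof.
by move=> YE; apply: (@mulrz_inj (denq t)); rewrite ?denq_neq0 // qscaleP.
Qed.

Lemma qscale_frac (n d : int) X Y :
  d != 0 -> Y *~ d = X *~ n -> qscale (n%:~R / d%:~R) X = Y.
Proof.
move=> d0 YE; set t := _ / _; apply: (@mulrz_inj (denq t * d)).
  by rewrite mulf_neq0 ?denq_neq0.
rewrite /= mulrzA qscaleP [denq t * d]mulrC mulrzA YE -!mulrzA.
congr (_ *~ _); apply: (@intr_inj rat); rewrite !rmorphM /=.
by rewrite numqE /t mulrAC divfK ?intr_eq0.
Qed.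

Lemma qscaleB s t X : qscale (s - t) X = qscale s X - qscale t X.
Proof.
have ds0 : (denq s)%:~R != 0 :> rat by rewrite intr_eq0 denq_neq0.
have dt0 : (denq t)%:~R != 0 :> rat by rewrite intr_eq0 denq_neq0.
have -> : s - t =
    (numq s * denq t - numq t * denq s)%:~R / (denq s * denq t)%:~R.
  rewrite rmorphB !rmorphM /= !numqE [t * _ * _]mulrAC -!mulrA -mulrBl.
  by rewrite mulfK // mulf_neq0.
apply: qscale_frac; first by rewrite mulf_neq0 ?denq_neq0.
rewrite mulrzBl {1}mulrzA qscaleP [denq s * _]mulrC mulrzA qscaleP -!mulrzA.
by rewrite mulrzBr.
Qed.

End Scaling.

Section Norm.
Context {R : realType} {F : perfectSemifield1Type}.
Implicit Types (X Y Z E : F) (nrm : F -> R).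

Definition bounds E X : set rat :=
  [set t | 0 <= t /\ sle (- qscale t E) X /\ sle X (qscale t E)].

Definition radius E X : R := inf [set (ratr t : R) | t in bounds E X].

Definition standing E : Prop :=
  [/\ exists X : F, X != 0,
      forall X, exists t, bounds E X t &
      forall X, radius E X = 0 <-> X = 0].

Record Fnorm E nrm : Prop := {
  Fnorm_ge0 : forall X, 0 <= nrm X;
  FnormZ : forall (t : rat) X, nrm (qscale t X) = `|ratr t| * nrm X;
  FnormD : forall X Y, nrm (X + Y) <= nrm X + nrm Y;
  radius_le_Fnorm : forall X, radius E X <= nrm X;
  Fnorm_oplus : forall X Y X' Y',
    nrm (X ⊕ Y - X' ⊕ Y') <= Num.max (nrm (X - X')) (nrm (Y - Y'))
}.

Definition converges_to nrm (u : nat -> F) (l : F) : Prop :=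
  (fun n => nrm (u n - l)) @ \oo --> (0 : R).

Definition cauchy_seq nrm (u : nat -> F) : Prop :=
  forall e : R, 0 < e -> exists N : nat,
    forall m n : nat, (N <= m)%N -> (N <= n)%N -> nrm (u m - u n) < e.

Definition complete_for nrm : Prop :=
  forall u : nat -> F, cauchy_seq nrm u -> exists l, converges_to nrm u l.

(* The real multiple t X is the common limit of the r_n X, for all sequences of
   rationals r_n tending to t; under the standing assumptions and completeness
   it exists and is unique, see rscaleP and converges_uniq. *)
Definition rscale nrm (t : R) X : F :=
  xget 0 [set Y : F | forall r : nat -> rat,
    (fun n => ratr (r n) : R) @ \oo --> t ->
    converges_to nrm (fun n => qscale (r n) X) Y].

Lemma converges_uniq E nrm u l l' : standing E -> Fnorm E nrm ->
  converges_to nrm u l -> converges_to nrm u l' -> l = l'.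
Proof.
move=> [_ hb rad0] hn ul ul'.
have nN X : nrm (- X) = nrm X.
  have -> : - X = qscale (- 1) X.
    by apply/esym/qscale_uniq; rewrite /= mulrN1z.
  by rewrite (FnormZ hn) rmorphN1 normrN1 mul1r.
have h0 : nrm (l - l') <= 0.
  apply/ler_addgt0Pr => e e0; rewrite add0r.
  have e2 : 0 < e / 2 by rewrite divr_gt0.
  have [N _ H] := (cvgr0Pnorm_lt _).1 ul _ e2.
  have [N' _ H'] := (cvgr0Pnorm_lt _).1 ul' _ e2.
  have {}H := H (maxn N N') (leq_maxl _ _).
  have {}H' := H' (maxn N N') (leq_maxr _ _).
  have -> : l - l' = - (u (maxn N N') - l) + (u (maxn N N') - l').
    by rewrite opprB addrA subrK.
  apply: (le_trans (FnormD hn _ _)); rewrite nN [leRHS]splitr.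
  by apply: lerD; [move: H | move: H']; rewrite /= ger0_norm ?(Fnorm_ge0 hn) // => /ltW.
apply/eqP; rewrite -subr_eq0; apply/eqP/rad0/le_anti.
rewrite (le_trans (radius_le_Fnorm hn _) h0) /=.
apply: lb_le_inf; last by move=> _ [q [q0 _] <-]; rewrite ler0q.
by have [q hq] := hb (l - l'); exists (ratr q), q.
Qed.

Lemma rscaleP E nrm t X (r : nat -> rat) :
  Fnorm E nrm -> complete_for nrm ->
  (fun n => ratr (r n) : R) @ \oo --> t ->
  converges_to nrm (fun n => qscale (r n) X) (rscale nrm t X).
Proof.
move=> hn hc; rewrite /rscale; case: xgetP => [Y -> /(_ r) //|noY _]; exfalso.
have [s st] : exists s : nat -> rat, (fun n => ratr (s n) : R) @ \oo --> t.
  have H n : exists q : rat, `|t - ratr q| < n.+1%:R^-1 :> R.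
    have /rat_in_itvoo[q] : t - n.+1%:R^-1 < t + n.+1%:R^-1 :> R.
      by rewrite ltrD2l gtrN ?invr_gt0 ?ltr0n.
    by rewrite in_itv /= => qt; exists q; rewrite distrC ltr_distl.
  have [s sP] := choice H; exists s; apply/cvgrPdist_lt => e e0.
  have [N _ HN] := near_infty_natSinv_lt (PosNum e0).
  by exists N => // n /HN /=; exact: lt_trans.
have dist a b : nrm (qscale a X - qscale b X) = `|ratr a - ratr b| * nrm X.
  by rewrite -qscaleB (FnormZ hn) rmorphB.
have nX := Fnorm_ge0 hn X.
have cvgM0 (a : nat -> R) : a @ \oo --> (0 : R) ->
    (fun n => `|a n| * nrm X) @ \oo --> (0 : R).
  move=> a0; rewrite -(mul0r (nrm X)) -[X in X * _](@normr0 _ R).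
  by apply: cvgMl; exact: cvg_norm.
have [Y sY] : exists Y, converges_to nrm (fun n => qscale (s n) X) Y.
  apply: hc => e e0.
  have d0 : 0 < e / (nrm X + 1) / 2 by rewrite !divr_gt0 // ltr_wpDl.
  have [N _ HN] := (cvgrPdist_lt _ _).1 st _ d0.
  exists N => m n mN nN; rewrite dist.
  have {}mN := HN m mN; have {}nN := HN n nN; rewrite /= in mN nN.
  have : `|ratr (s m) - ratr (s n)| <= e / (nrm X + 1) :> R.
    rewrite [leRHS]splitr -(subrKA t).
    apply: (le_trans (ler_normD _ _)); rewrite distrC.
    by apply: lerD; exact: ltW.
  move=> /(ler_wpM2r nX) /le_lt_trans; apply.
  by rewrite mulrAC ltr_pdivrMr ?ltr_wpDl // ltr_pM2l // ltrDl.
apply: (noY Y) => r' r't.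
have r's : (fun n => ratr (r' n) - ratr (s n) : R) @ \oo --> (0 : R).
  by rewrite -(subrr t); exact: cvgB.
have h0 : (fun n => `|ratr (r' n) - ratr (s n)| * nrm X +
    nrm (qscale (s n) X - Y)) @ \oo --> (0 : R).
  by rewrite -(addr0 0); apply: cvgD; [exact: cvgM0 | exact: sY].
have c0 : (fun=> 0 : R) @ \oo --> (0 : R) by exact: cvg_cst.
rewrite /converges_to; apply: (squeeze_cvgr _ c0 h0).
near=> n; rewrite (Fnorm_ge0 hn) /= -dist.
by rewrite -[X in nrm X <= _](subrKA (qscale (s n) X)) (FnormD hn).
Unshelve. all: by end_near.
Qed.

End Norm.

Section Congruence.
Context {F : perfectSemifield1Type}.

Record congruence := Congruence {
  cong_rel :> equiv_rel F;
  congN : forall X Y, cong_rel X Y -> cong_rel (- X) (- Y);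
  congD : forall Z X Y, cong_rel X Y -> cong_rel (X + Z) (Y + Z);
  cong_oplus : forall Z X Y, cong_rel X Y -> cong_rel (X ⊕ Z) (Y ⊕ Z)
}.

Definition cong_trivial (c : congruence) : Prop := forall X Y, c X Y.

Definition cong_le (c c' : congruence) : Prop := forall X Y, c X Y -> c' X Y.

Definition cong_maximal (c : congruence) : Prop :=
  ~ cong_trivial c /\
  forall c' : congruence, cong_le c c' -> c' =2 c \/ cong_trivial c'.

End Congruence.
Arguments congruence : clear implicits.

Section Quotient.
Context {F : perfectSemifield1Type} (c : congruence F).

Definition cquot : Type := {eq_quot c}.
HB.instance Definition _ := Choice.on cquot.
HB.instance Definition _ := EqQuotient.on cquot.

Definition cquot_zero : cquot := \pi_cquot 0.
Definition cquot_opp (x : cquot) : cquot := \pi_cquot (- repr x).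
Definition cquot_add (x y : cquot) : cquot := \pi_cquot (repr x + repr y).
Definition cquot_oplus (x y : cquot) : cquot := \pi_cquot (repr x ⊕ repr y).

Lemma pi_eqP X Y : reflect (\pi_cquot X = \pi_cquot Y) (c X Y).
Proof. exact: (@eqquotP _ _ {eq_quot c}). Qed.

Lemma cquotW (P : cquot -> Prop) : (forall X, P (\pi_cquot X)) -> forall x, P x.
Proof. exact: quotW. Qed.

Lemma cong_repr X : c (repr (\pi_cquot X)) X.
Proof. by apply/pi_eqP; rewrite reprK. Qed.

Lemma pi_opp X : \pi_cquot (- X) = cquot_opp (\pi_cquot X).
Proof. by apply/esym/pi_eqP/congN/cong_repr. Qed.

Lemma pi_add X Y : \pi_cquot (X + Y) = cquot_add (\pi_cquot X) (\pi_cquot Y).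
Proof.
apply/esym/pi_eqP/(@generic_quotient.equiv_trans _ c (X + repr (\pi_cquot Y))).
  exact/congD/cong_repr.
by rewrite ![X + _]addrC; apply/congD/cong_repr.
Qed.

Lemma pi_oplus X Y :
  \pi_cquot (X ⊕ Y) = cquot_oplus (\pi_cquot X) (\pi_cquot Y).
Proof.
apply/esym/pi_eqP/(@generic_quotient.equiv_trans _ c (X ⊕ repr (\pi_cquot Y))).
  exact/cong_oplus/cong_repr.
by rewrite ![X ⊕ _]oplusC; apply/cong_oplus/cong_repr.
Qed.

Fact cquot_addA : associative cquot_add.
Proof. move=> x y z; elim/cquotW: x => X; elim/cquotW: y => Y; elim/cquotW: z => Z.
by rewrite -!pi_add addrA. Qed.
Fact cquot_addC : commutative cquot_add.
Proof. by move=> x y; elim/cquotW: x => X; elim/cquotW: y => Y; rewrite -!pi_add addrC. Qed.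
Fact cquot_add0 : left_id cquot_zero cquot_add.
Proof. by move=> x; elim/cquotW: x => X; rewrite -!pi_add add0r. Qed.
Fact cquot_addN : left_inverse cquot_zero cquot_opp cquot_add.
Proof. by move=> x; elim/cquotW: x => X; rewrite -pi_opp -!pi_add addNr. Qed.

HB.instance Definition _ := GRing.isZmodule.Build cquot
  cquot_addA cquot_addC cquot_add0 cquot_addN.

Lemma pi_mulrn X n : \pi_cquot (X *+ n) = \pi_cquot X *+ n.
Proof. by elim: n => // n IH; rewrite !mulrS pi_add IH. Qed.

Fact cquot_oplusA : associative cquot_oplus.
Proof. move=> x y z; elim/cquotW: x => X; elim/cquotW: y => Y; elim/cquotW: z => Z.
by rewrite -!pi_oplus oplusA. Qed.
Fact cquot_oplusC : commutative cquot_oplus.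
Proof. by move=> x y; elim/cquotW: x => X; elim/cquotW: y => Y; rewrite -!pi_oplus oplusC. Qed.
Fact cquot_oplusxx : idempotent_op cquot_oplus.
Proof. by move=> x; elim/cquotW: x => X; rewrite -!pi_oplus oplusxx. Qed.
Fact cquot_addr_oplusr : right_distributive +%R cquot_oplus.
Proof.
move=> x y z; elim/cquotW: x => X; elim/cquotW: y => Y; elim/cquotW: z => Z.
by rewrite -pi_oplus /GRing.add /= -!pi_add -pi_oplus addr_oplusr.
Qed.
Fact cquot_mulrn_surj n :
  (0 < n)%N -> forall x : cquot, exists y : cquot, y *+ n = x.
Proof.
move=> n0 x; elim/cquotW: x => X; have [Y <-] := mulrn_surj n n0 X.
by exists (\pi_cquot Y); rewrite pi_mulrn.
Qed.

HB.instance Definition _ := isPerfectSemifield1.Build cquot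
  cquot_oplusA cquot_oplusC cquot_oplusxx cquot_addr_oplusr cquot_mulrn_surj.

(* When F is complete for the F-norm nrm, this does not depend on the chosen
   representative: any t D is the limit of r_n D with
   - k (D ⊕ - D) <= r_n D <= k (D ⊕ - D), so that D ~ 0 implies t D ~ 0. *)
Definition cquot_scale {R : realType} (nrm : F -> R) (t : R) (x : cquot) :
  cquot := \pi_cquot (rscale nrm t (repr x)).

End Quotient.

(* A copy of R, carrying the semi-field structure (R, max, +). *)
Definition Rmax (R : realType) : Type := R.

Section Rmax.
Context {R : realType}.

HB.instance Definition _ := GRing.Zmodule.copy (Rmax R) R.

Definition Rmax_oplus (x y : Rmax R) : Rmax R := Num.max (x : R) (y : R).

Fact Rmax_oplusA : associative Rmax_oplus.
Proof. exact: (@maxA _ R). Qed.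
Fact Rmax_oplusC : commutative Rmax_oplus.
Proof. exact: (@maxC _ R). Qed.
Fact Rmax_oplusxx : idempotent_op Rmax_oplus.
Proof. exact: (@maxxx _ R). Qed.
Fact Rmax_addr_oplusr : right_distributive +%R Rmax_oplus.
Proof. exact: (@addr_maxr R). Qed.
Fact Rmax_mulrn_surj n :
  (0 < n)%N -> forall x : Rmax R, exists y : Rmax R, y *+ n = x.
Proof.
move=> n0 x; exists ((x : R) / n%:R).
by rewrite -[LHS](@mulr_natr R) divfK // pnatr_eq0 -lt0n.
Qed.

HB.instance Definition _ := isPerfectSemifield1.Build (Rmax R)
  Rmax_oplusA Rmax_oplusC Rmax_oplusxx Rmax_addr_oplusr Rmax_mulrn_surj.

End Rmax.

(* Main.v *)
(* F is a divisible lattice-ordered group, and congruences correspond to its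
   convex lattice-ordered subgroups. If c is maximal, every nonzero d >= 0 in
   F/c generates F/c as an ideal, so F/c is archimedean; it is also totally
   ordered, for otherwise some disjoint elements x^+ and x^- would both generate
   F/c, whence every element would be below a meet N x^+ /\ N x^- = 0. Hoelder's
   theorem embeds F/c into R with the class of E sent to 1. Completeness makes
   this onto: the induced g : F -> R satisfies |g X| <= r(X) <= ||X||, so it is
   continuous and commutes with real scaling. *)
Require Import Defs.
From HB Require Import structures.
From mathcomp Require Import all_boot all_order all_algebra.
From mathcomp Require Import all_classical all_reals all_analysis.

Set Implicit Arguments.
Unset Strict Implicit.
Unset Printing Implicit Defensive.

Local Open Scope quotient_scope.
Local Open Scope ring_scope.

Import Order.TTheory GRing.Theory Num.Theory.
Import numFieldNormedType.Exports.

(** * Lattice-ordered group facts for the order [sle] *)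

Section SemifieldOrder.
Context {F : perfectSemifield1Type}.
Implicit Types (X Y Z : F) (n : nat).

Lemma sle_refl X : sle X X.
Proof. exact: oplusxx. Qed.

Lemma sle_trans Y X Z : sle X Y -> sle Y Z -> sle X Z.
Proof. by rewrite /sle => XY YZ; rewrite -YZ oplusA XY. Qed.

Lemma sle_anti X Y : sle X Y -> sle Y X -> X = Y.
Proof. by rewrite /sle => XY YX; rewrite -XY oplusC YX. Qed.

Lemma sleDr Z X Y : sle X Y -> sle (X + Z) (Y + Z).
Proof. by rewrite /sle -addr_oplusl => ->. Qed.

Lemma sleDl Z X Y : sle X Y -> sle (Z + X) (Z + Y).
Proof. by rewrite ![Z + _]addrC; exact: sleDr. Qed.

Lemma sleD X Y X' Y' : sle X Y -> sle X' Y' -> sle (X + X') (Y + Y').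
Proof. by move=> XY XY'; apply: (sle_trans (sleDr X' XY) (sleDl Y XY')). Qed.

Lemma sleN X Y : sle X Y -> sle (- Y) (- X).
Proof.
by move=> /(sleDr (- X - Y)); rewrite addrA subrr add0r addrCA subrr addr0.
Qed.

Lemma subs_ge0 X Y : sle 0 (Y - X) <-> sle X Y.
Proof.
split=> [/(sleDr X)|/(sleDr (- X))]; first by rewrite add0r subrK.
by rewrite subrr.
Qed.

Lemma sle_oplusl X Y : sle X (X ⊕ Y).
Proof. by rewrite /sle oplusA oplusxx. Qed.

Lemma sle_oplusr X Y : sle Y (X ⊕ Y).
Proof. by rewrite oplusC; exact: sle_oplusl. Qed.

Lemma oplus_sle X Y Z : sle X Z -> sle Y Z -> sle (X ⊕ Y) Z.
Proof. by rewrite /sle => XZ YZ; rewrite -oplusA YZ. Qed.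

Lemma sleMn n X Y : sle X Y -> sle (X *+ n) (Y *+ n).
Proof.
by move=> XY; elim: n => [|n IH]; [exact: sle_refl | rewrite !mulrS; exact: sleD].
Qed.

Lemma mulrn_sge0 n X : sle 0 X -> sle 0 (X *+ n).
Proof. by move/(sleMn n); rewrite mul0rn. Qed.

Lemma mulrn_sle m n X : sle 0 X -> (m <= n)%N -> sle (X *+ m) (X *+ n).
Proof.
move=> X0 /subnK <-; rewrite mulrnDr -{1}[X *+ m]add0r.
exact/sleDr/mulrn_sge0.
Qed.

(** Doubling [0 ⊕ X] gives [0 ⊕ X ⊕ 2X], where [2X] absorbs [0]; cancelling [0 ⊕ X] leaves
    [0 ⊕ X = X]. *)
Lemma double_sge0 X : sle 0 (X *+ 2) -> sle 0 X.
Proof.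
move=> X20; have X2X : 0 ⊕ X + (0 ⊕ X) = 0 ⊕ X + X.
  rewrite addr_oplusr addr0 addr_oplusl add0r -mulr2n.
  by rewrite -oplusA [X ⊕ (_ ⊕ _)]oplusA oplusxx [X ⊕ _]oplusC oplusA X20.
exact: addrI X2X.
Qed.

Lemma sabs_ge0 X : sle 0 (X ⊕ - X).
Proof.
apply: double_sge0; rewrite mulr2n addr_oplusr addr_oplusl addNr.
exact: sle_trans (sle_oplusr _ 0) (sle_oplusl _ _).
Qed.

(** The double expands to [2X ⊕ X ⊕ 0]; the term [X] is redundant because [(2X ⊕ 0) - X] is
    [X ⊕ - X], which is positive. *)
Lemma double_pos X : (X ⊕ 0) *+ 2 = X *+ 2 ⊕ 0.
Proof.
rewrite mulr2n addr_oplusr addr0 addr_oplusl add0r -mulr2n.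
apply: sle_anti; last first.
  apply: oplus_sle; last exact: sle_trans (sle_oplusr _ _) (sle_oplusr _ _).
  exact: sle_trans (sle_oplusl _ _) (sle_oplusl _ _).
have X1 : sle X (X *+ 2 ⊕ 0).
  apply/subs_ge0; rewrite addr_oplusl sub0r mulr2n addrK; exact: sabs_ge0.
apply: oplus_sle; apply: oplus_sle => //; [exact: sle_oplusl|exact: sle_oplusr].
Qed.

(** Iterated doubling suffices for the archimedean argument: any multiple of a positive element lies
    below a power-of-two multiple. *)
Lemma mulr_pow2_pos n X : (X ⊕ 0) *+ (2 ^ n) = X *+ (2 ^ n) ⊕ 0.
Proof.
by elim: n => [|n IH]; rewrite ?mulr1n // expnSr !mulrnA IH double_pos.
Qed.

(* The meet of X^+ = X ⊕ 0 and X^- = - X ⊕ 0 is 0. *)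
Lemma sle_pos_neg X Z : sle Z (X ⊕ 0) -> sle Z (- X ⊕ 0) -> sle Z 0.
Proof.
move=> ZX /(sleDr X); rewrite addr_oplusl addNr add0r [0 ⊕ _]oplusC => ZX'.
have : sle (Z + (X ⊕ 0)) (0 + (X ⊕ 0)).
  by rewrite addr_oplusr addr0 add0r; exact: oplus_sle.
by move=> /(sleDr (- (X ⊕ 0))); rewrite !addrK.
Qed.

End SemifieldOrder.

(** * Rational scaling and rational approximation of reals *)

Section RationalScaling.
Context {R : realType}.

Lemma le_ratr_dense (a b : R) :
  (forall q : rat, ratr q < a -> ratr q <= b) -> a <= b.
Proof.
move=> H; rewrite leNgt; apply/negP => /rat_in_itvoo[q].
by rewrite in_itv /= => /andP[bq /H]; rewrite leNgt bq.
Qed.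

Lemma rat_cvg (t : R) : exists r : nat -> rat,
  ((fun n => ratr (r n) : R) @ \oo --> t)%classic.
Proof.
have H n : exists q : rat, `|t - ratr q| < n.+1%:R^-1 :> R.
  have /rat_in_itvoo[q] : t - n.+1%:R^-1 < t + n.+1%:R^-1 :> R.
    by rewrite ltrD2l gtrN ?invr_gt0 ?ltr0n.
  by rewrite in_itv /= => qt; exists q; rewrite distrC ltr_distl.
have [r rP] := choice H; exists r; apply/cvgrPdist_lt => e e0.
have [N _ HN] := near_infty_natSinv_lt (PosNum e0).
by exists N => // n /HN /=; exact: lt_trans.
Qed.

Lemma qscale1 (F : perfectSemifield1Type) (X : F) : qscale 1 X = X.
Proof. exact: qscale_uniq. Qed.

Lemma qscaleN (F : perfectSemifield1Type) q (X : F) :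
  qscale (- q) X = - qscale q X.
Proof.
have q0 : qscale 0 X = 0 by apply: qscale_uniq; rewrite mul0rz.
by rewrite -[- q]add0r qscaleB q0 sub0r.
Qed.

Lemma qscaleD (F : perfectSemifield1Type) p q (X : F) :
  qscale (p + q) X = qscale p X + qscale q X.
Proof. by rewrite -[q]opprK qscaleB qscaleN !opprK. Qed.

Lemma additive_qscale (F : perfectSemifield1Type) (g : {additive F -> R}) q X :
  g (qscale q X) = ratr q * g X.
Proof.
have d0 : (denq q)%:~R != 0 :> R by rewrite intr_eq0 denq_neq0.
apply: (mulIf d0); rewrite mulrzr -raddfMz qscaleP raddfMz -mulrzr.
by rewrite mulrAC [g X * _]mulrC /ratr divfK.
Qed.

End RationalScaling.

(** * Hoelder embedding of a totally ordered archimedean semi-field *)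

Section Hoelder.
Context {R : realType} {G : perfectSemifield1Type} (e : G).
Hypothesis sle_total : forall x y : G, sle x y \/ sle y x.
Hypothesis e_ge0 : sle 0 e.
Hypothesis e_neq0 : e != 0.
Hypothesis archimedean : forall d : G, sle 0 d -> d != 0 ->
  forall x : G, exists n, sle x (d *+ n).

Lemma mulrn_sge0_inv n (x : G) : (0 < n)%N -> sle 0 (x *+ n) -> sle 0 x.
Proof.
move=> n0 xn; have [//|x0] := sle_total 0 x.
have xn0 : x *+ n = 0.
  by apply: sle_anti => //; move/(sleMn n): x0; rewrite mul0rn.
by rewrite (mulrn_eq0_torsion n0 xn0); exact: sle_refl.
Qed.

Lemma qscale_sge0 (q : rat) : 0 <= q -> sle 0 (qscale q e).
Proof.
rewrite -numq_ge0; have := qscaleP q e.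
case: (denq q) (denq_gt0 q) => // d d0; case: (numq q) => // n qe _.
by apply: (mulrn_sge0_inv d0); rewrite pmulrn qe; exact: mulrn_sge0.
Qed.

(** A negative [q] would force [qscale q e = 0], against torsion-freeness and [e != 0]. *)
Lemma qscale_ge0 (q : rat) : sle 0 (qscale q e) -> 0 <= q.
Proof.
move=> qe; rewrite leNgt; apply/negP => q0.
have qe0 : qscale q e = 0.
  apply: sle_anti => //; rewrite -[qscale q e]opprK -[X in sle _ X]oppr0.
  by apply: sleN; rewrite -qscaleN; apply: qscale_sge0; rewrite oppr_ge0 ltW.
have := qscaleP q e; rewrite qe0 mul0rz => /esym.
rewrite -[RHS](mul0rz G (numq q)) => /mulrz_inj e0.
by move/eqP: e_neq0; apply; apply: e0; rewrite numq_eq0 lt_eqF.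
Qed.

Lemma qscale_le (p q : rat) : sle (qscale p e) (qscale q e) -> p <= q.
Proof. by rewrite -subs_ge0 -qscaleB => /qscale_ge0; rewrite subr_ge0. Qed.

Lemma qscale_nat n : qscale n%:R e = e *+ n.
Proof.
by elim: n => [|n IH]; [apply: qscale_uniq; rewrite mul0rz |
  rewrite -natr1 qscaleD IH qscale1 mulrSr].
Qed.

(** The Dedekind cut of the ratio of [x] to the unit [e]. *)
Definition lower_cut (x : G) : set R :=
  [set (ratr q : R) | q in [set q | sle (qscale q e) x]]%classic.

Definition hoelder (x : G) : R := sup (lower_cut x).

Lemma lower_cut_nonempty x : (lower_cut x !=set0)%classic.
Proof.
have [n xn] := archimedean e_ge0 e_neq0 (- x).
exists (ratr (- n%:R)), (- n%:R) => //=.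
by rewrite qscaleN qscale_nat -[X in sle _ X]opprK; exact: sleN.
Qed.

Lemma lower_cut_ub q x : sle x (qscale q e) -> ubound (lower_cut x) (ratr q).
Proof. by move=> xq _ [p /= px <-]; rewrite ler_rat; exact/qscale_le/sle_trans/xq. Qed.

Lemma hoelder_ge q x : sle (qscale q e) x -> ratr q <= hoelder x.
Proof.
move=> qx; apply: ub_le_sup; last by exists q.
(* The archimedean bound on [x] bounds the cut above; otherwise [sup] would be a default value. *)
have [n xn] := archimedean e_ge0 e_neq0 x.
by exists (ratr n%:R); apply: lower_cut_ub; rewrite qscale_nat.
Qed.

Lemma hoelder_le q x : sle x (qscale q e) -> hoelder x <= ratr q.
Proof. by move=> xq; apply: ge_sup (lower_cut_nonempty x) (lower_cut_ub xq). Qed.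

(** Totality carries strict inequalities in [R] back to the order of [G]. *)
Lemma hoelder_lt q x : hoelder x < ratr q -> sle x (qscale q e).
Proof.
by have [//|/hoelder_ge] := sle_total x (qscale q e); rewrite leNgt => /negP.
Qed.

Lemma hoelder_gt q x : ratr q < hoelder x -> sle (qscale q e) x.
Proof.
by have [//|/hoelder_le] := sle_total (qscale q e) x; rewrite leNgt => /negP.
Qed.

Lemma hoelderN x : hoelder (- x) = - hoelder x.
Proof.
apply/le_anti/andP; split; apply: le_ratr_dense => q.
  move=> /hoelder_gt /sleN; rewrite opprK -qscaleN => /hoelder_le.
  by rewrite rmorphN lerNr.
rewrite ltrNr -rmorphN => /hoelder_lt /sleN.
by rewrite qscaleN opprK => /hoelder_ge.
Qed.

(** Points of the two cuts add up to a point of the cut of the sum. *)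
Lemma hoelder_superD x y : hoelder x + hoelder y <= hoelder (x + y).
Proof.
rewrite -lerBrDr; apply: le_ratr_dense => p /hoelder_gt px.
rewrite lerBrDr -lerBrDl; apply: le_ratr_dense => q /hoelder_gt qy.
by rewrite lerBrDl -rmorphD; apply: hoelder_ge; rewrite qscaleD; exact: sleD.
Qed.

(** Superadditivity for [x] and [- y] gives one inequality, and for [x - y] and [y] the other. *)
Lemma hoelderB : zmod_morphism hoelder.
Proof.
move=> x y; apply/le_anti; rewrite -{2}hoelderN hoelder_superD andbT lerBrDr.
by apply: (le_trans (hoelder_superD _ _)); rewrite subrK.
Qed.

HB.instance Definition _ := GRing.isZmodMorphism.Build G R hoelder hoelderB.

Lemma hoelder_homo x y : sle x y -> hoelder x <= hoelder y.
Proof.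
by move=> xy; apply: le_ratr_dense => q /hoelder_gt qx; exact/hoelder_ge/sle_trans/xy.
Qed.

Lemma hoelder_unit : hoelder e = 1.
Proof.
rewrite -(rmorph1 (ratr : rat -> R)); apply/le_anti.
by rewrite hoelder_le ?hoelder_ge // qscale1; exact: sle_refl.
Qed.

Lemma hoelder_oplus : {morph hoelder : x y / x ⊕ y >-> Num.max x y}.
Proof.
move=> x y; have [xy|yx] := sle_total x y.
  by rewrite xy max_r // hoelder_homo.
by rewrite oplusC yx max_l // hoelder_homo.
Qed.

(** A nonzero positive [x] in the kernel would have a multiple above [e], giving [1 <= 0]. *)
Lemma hoelder_inj : injective hoelder.
Proof.
apply: raddf_inj.
have H x : sle 0 x -> hoelder x = 0 -> x = 0.
  move=> x0 hx0; apply/eqP; apply/negP => /negP x_neq0.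
  have [n /hoelder_homo] := archimedean x0 x_neq0 e.
  by rewrite hoelder_unit raddfMn /= hx0 mul0rn leNgt ltr01.
move=> x hx0; have [/H|/sleN] := sle_total 0 x; first exact.
rewrite oppr0 => /H; rewrite hoelderN hx0 oppr0 => /(_ erefl) /eqP.
by rewrite oppr_eq0 => /eqP.
Qed.

Lemma hoelder_embedding : exists g : {additive G -> R},
  [/\ {morph g : x y / x ⊕ y >-> Num.max x y}, injective g & g e = 1].
Proof.
by exists hoelder; split; [exact: hoelder_oplus|exact: hoelder_inj|exact: hoelder_unit].
Qed.

End Hoelder.

(** * Continuity and real homogeneity of monotone additive maps *)

Section RealScaling.
Context {R : realType} {F : perfectSemifield1Type} (E : F) (nrm : F -> R).
Hypothesis hE : standing (R := R) E.
Hypothesis hnrm : Fnorm E nrm.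
Hypothesis hcomplete : complete_for nrm.
Variable g : {additive F -> R}.
Hypothesis g_homo : forall X Y, sle X Y -> g X <= g Y.
Hypothesis gE : g E = 1.

(** Applying [g] to [- tE <= X <= tE] bounds [g X] in absolute value by [t]; the infimum over [t] is
    the radius. *)
Lemma additive_le_Fnorm X : `|g X| <= nrm X.
Proof.
have [_ hb _] := hE; apply: le_trans (radius_le_Fnorm hnrm X).
apply: lb_le_inf; first by have [t tX] := hb X; exists (ratr t), t.
move=> _ [t [_ [tX Xt]] <-]; rewrite ler_norml.
move: (g_homo tX) (g_homo Xt).
by rewrite raddfN additive_qscale gE mulr1 => -> ->.
Qed.

(** For rationals [r n] tending to [t], the values [g (qscale (r n) X)] converge to both sides: by
    rational homogeneity, and by continuity of [g] for the norm. *)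
Lemma additive_rscale t X : g (rscale nrm t X) = t * g X.
Proof.
have [r rt] := rat_cvg t.
have rX := rscaleP X hnrm hcomplete rt.
have lim1 : ((fun n => g (qscale (r n) X)) @ \oo --> t * g X)%classic.
  under eq_fun do rewrite additive_qscale.
  exact: cvgMr_tmp.
have lim2 : ((fun n => g (qscale (r n) X)) @ \oo --> g (rscale nrm t X))%classic.
  apply/cvgrPdist_le => e e0; have [N _ HN] := (cvgr0Pnorm_lt _).1 rX _ e0.
  exists N => // n /HN /= /ltW; rewrite ger0_norm ?(Fnorm_ge0 hnrm) //.
  by apply: le_trans; rewrite distrC -raddfB; exact: additive_le_Fnorm.
exact: cvg_unique lim2 lim1.
Qed.

End RealScaling.

(** * The quotient by a maximal congruence is archimedean and totally ordered *)

Section MaximalCongruence.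
Context {F : perfectSemifield1Type} (c : congruence F).
Implicit Types (a d x y : cquot c) (X Y : F).
Let p X : cquot c := \pi_(cquot c) X.

Lemma piN X : p (- X) = - p X.
Proof. exact: Defs.pi_opp. Qed.

Lemma piD X Y : p (X + Y) = p X + p Y.
Proof. exact: Defs.pi_add. Qed.

Lemma pi0 : p 0 = 0.
Proof. by apply: (addrI (p 0)); rewrite -piD !addr0. Qed.

Lemma pi_oplusE X Y : p (X ⊕ Y) = p X ⊕ p Y.
Proof. exact: pi_oplus. Qed.

Lemma pi_surj x : exists X, x = p X.
Proof. by exists (repr x); rewrite /p reprK. Qed.

Lemma sle_pi X Y : sle X Y -> sle (p X) (p Y).
Proof. by rewrite /sle -pi_oplusE => ->. Qed.

(* The congruence on F whose class of 0 is the preimage of the ideal of F/c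
   generated by a. *)
Definition coarse_rel a X Y : Prop :=
  exists n, sle (p X) (p Y + a *+ n) /\ sle (p Y) (p X + a *+ n).

Definition coarse_eq a : rel F := fun X Y => `[< coarse_rel a X Y >].

Lemma coarse_eq_refl a : reflexive (coarse_eq a).
Proof. by move=> X; apply/asboolP; exists 0%N; rewrite addr0; split; exact: sle_refl. Qed.

Lemma coarse_eq_sym a : symmetric (coarse_eq a).
Proof. by move=> X Y; apply/asbool_equiv_eq; split=> -[n [XY YX]]; exists n. Qed.

Lemma coarse_eq_trans a : transitive (coarse_eq a).
Proof.
move=> Y X Z /asboolP[m [XY YX]] /asboolP[n [YZ ZY]]; apply/asboolP.
exists (m + n)%N; rewrite mulrnDr; split.
  by apply: (sle_trans XY); rewrite [a *+ m + _]addrC addrA; exact: sleDr.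
by apply: (sle_trans ZY); rewrite addrA; exact: sleDr.
Qed.

Definition coarse_equiv a :=
  EquivRel (coarse_eq a) (coarse_eq_refl a) (coarse_eq_sym a) (@coarse_eq_trans a).

Lemma coarse_eqN a X Y : coarse_eq a X Y -> coarse_eq a (- X) (- Y).
Proof.
move=> /asboolP[n [XY YX]]; apply/asboolP; exists n; rewrite !piN.
split; [move: YX | move: XY] => /sleN /(sleDr (a *+ n)).
all: by rewrite opprD subrK.
Qed.

Lemma coarse_eqD a Z X Y : coarse_eq a X Y -> coarse_eq a (X + Z) (Y + Z).
Proof.
move=> /asboolP[n [XY YX]]; apply/asboolP; exists n.
by rewrite !piD ![_ + p Z + _]addrAC; split; exact: sleDr.
Qed.

Lemma coarse_eq_oplus a Z X Y :
  sle 0 a -> coarse_eq a X Y -> coarse_eq a (X ⊕ Z) (Y ⊕ Z).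
Proof.
move=> a0 /asboolP[n [XY YX]]; apply/asboolP; exists n.
(* Positivity of [a] is what lets the common joinand [Z] absorb the error [a *+ n]. *)
have Za : sle (p Z) (p Z + a *+ n).
  by rewrite -{1}[p Z]addr0; exact/sleDl/mulrn_sge0.
rewrite !pi_oplusE !addr_oplusl; split; apply: oplus_sle.
all: by [apply: sle_trans (sle_oplusl _ _) | apply: sle_trans (sle_oplusr _ _)].
Qed.

Definition coarse_cong a (a0 : sle 0 a) : congruence F :=
  @Congruence F (coarse_equiv a) (@coarse_eqN a) (@coarse_eqD a)
    (fun Z X Y => @coarse_eq_oplus a Z X Y a0).

Hypothesis hmax : cong_maximal c.

(** The coarse congruence of [d] contains [c] and identifies a representative of [d] with [0], which
    [c] does not; by maximality it is trivial, so multiples of [d] dominate everything. *)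
Lemma maximal_archimedean d : sle 0 d -> d != 0 ->
  forall x, exists n, sle x (d *+ n).
Proof.
move=> d0 d_neq0; have c_near : cong_le c (coarse_cong d0).
  move=> X Y /pi_eqP XY; apply/asboolP; exists 0%N.
  by rewrite !addr0 /p XY; split; exact: sle_refl.
have [coarse_c|triv] := hmax.2 _ c_near; last first.
  move=> x; have [X ->] := pi_surj x.
  by have /asboolP[n [Xn _]] := triv X 0; exists n; move: Xn; rewrite pi0 add0r.
move: d0 d_neq0 c_near coarse_c; have [D ->] := pi_surj d => d0 /negP D0 _ coarse_c.
case: D0; apply/eqP; apply: (pi_eqP c D 0 _); rewrite -coarse_c; apply/asboolP.
exists 1%N; rewrite pi0 add0r mulr1n; split; first exact: sle_refl.
by rewrite -[X in sle X _]addr0; exact: sleD.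
Qed.

Lemma maximal_nontrivial : ~ (forall x, sle x 0).
Proof.
move=> le0; apply: hmax.1 => X Y; apply/pi_eqP.
have eq0 x : x = 0.
  apply: sle_anti; first exact: le0.
  by rewrite -[x]opprK -[X in sle X _]oppr0; exact/sleN.
by rewrite [LHS]eq0 [RHS]eq0.
Qed.

Lemma maximal_total x y : sle x y \/ sle y x.
Proof.
suff H (z : cquot c) : sle z 0 \/ sle (- z) 0.
  have [/(sleDr y)|/(sleDr x)] := H (x - y); rewrite ?opprB subrK add0r.
    by left.
  by right.
have pos_eq0 (z' : cquot c) : z' ⊕ 0 = 0 -> sle z' 0 by [].
have [/pos_eq0|/eqP z1] := eqVneq (z ⊕ 0) 0; first by left.
have [/pos_eq0|/eqP z2] := eqVneq (- z ⊕ 0) 0; first by right.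
(* With both parts of [z] nonzero, an arbitrary [x'] is bounded by multiples of each, hence by
   [0]. *)
case: maximal_nontrivial => x'.
have [m xm] := maximal_archimedean (sle_oplusr z 0) (introN eqP z1) x'.
have [n xn] := maximal_archimedean (sle_oplusr (- z) 0) (introN eqP z2) x'.
(* The common multiplier [2 ^ (m + n)] dominates both [m] and [n] and commutes with taking positive
   parts. *)
have le_pow k : (k <= m + n -> k <= 2 ^ (m + n))%N.
  by move/leq_trans; apply; exact/ltnW/ltn_expl.
apply: (@sle_pos_neg _ (z *+ 2 ^ (m + n))).
  rewrite -mulr_pow2_pos; apply: (sle_trans xm).
  exact/mulrn_sle/le_pow/leq_addr/sle_oplusr.
rewrite -mulNrn -mulr_pow2_pos; apply: (sle_trans xn).
exact/mulrn_sle/le_pow/leq_addl/sle_oplusr.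
Qed.

(** If the class of [E] were below [0], the bounds [X <= tE] with [t >= 0] would put every class
    below [0]. *)
Lemma maximal_unit (R : realType) (E : F) : standing (R := R) E ->
  sle 0 (p E) /\ p E != 0.
Proof.
move=> [_ hb _].
suff H : ~ sle (p E) 0.
  have [E0|//] := maximal_total 0 (p E).
  by split=> //; apply/eqP => E00; apply: H; rewrite E00; exact: sle_refl.
move=> E0; apply: maximal_nontrivial => x.
have [X ->] := pi_surj x; have [t [t0 [_ Xt]]] := hb X.
have := qscaleP t E; have := denq_gt0 t; move: t0; rewrite -numq_ge0.
case: (denq t) => // d; case: (numq t) => // n _ d0 tE.
(* For [p X] positive, clearing denominators gives [p X *+ d <= p E *+ n <= 0], so [p X] is torsion
   and vanishes. *)
have [X0|//] := maximal_total 0 (p X); suff -> : p X = 0 by exact: sle_refl.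
apply: (mulrn_eq0_torsion d0); apply: sle_anti; last exact: mulrn_sge0.
move: (sle_pi (sleMn d Xt)); rewrite {1}/p pi_mulrn => /sle_trans; apply.
by rewrite pmulrn tE -pmulrn /p pi_mulrn -(mul0rn _ n); exact: sleMn.
Qed.

End MaximalCongruence.

Theorem theorem3 (R : realType) (F : perfectSemifield1Type) (E : F)
    (nrm : F -> R) (c : congruence F)
    (hE : standing (R := R) E)
    (hnrm : Fnorm E nrm)
    (hcomplete : complete_for nrm)
    (hmax : cong_maximal c) :
  let piE : cquot c := \pi_(cquot c) E in
  (forall x : cquot c, exists t : R, x = cquot_scale nrm t piE) /\
  exists f : cquot c -> Rmax R,
    (forall t : R, f (cquot_scale nrm t piE) = t) /\ semifield_iso f.
Proof.
move=> piE; have [E0 E_neq0] := maximal_unit hmax hE.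
have [f [f_oplus f_inj fE]] := hoelder_embedding (R := R) (maximal_total hmax)
  E0 E_neq0 (maximal_archimedean hmax).
(* Pulling [f] back to [F] makes the norm estimates available. *)
pose g X := f (\pi_(cquot c) X).
have gB : zmod_morphism g.
  by move=> X Y; rewrite /g -raddfB Defs.pi_add Defs.pi_opp.
pose ga : {additive F -> R} := HB.pack g (GRing.isZmodMorphism.Build F R g gB).
have g_homo X Y : sle X Y -> ga X <= ga Y.
  by move=> /(@sle_pi _ c) XY; rewrite /= /g -[X in _ <= f X]XY f_oplus le_max lexx.
have fS t : f (cquot_scale nrm t piE) = t.
  rewrite -[LHS]/(ga _) (additive_rscale hE hnrm hcomplete g_homo fE).
  by rewrite /= /g reprK fE mulr1.
(* By [fS], real scaling of [piE] is a right inverse of [f]; injectivity makes it two-sided. *)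
have fK x : cquot_scale nrm (f x) piE = x by apply: f_inj; rewrite fS.
split; first by move=> x; exists (f x).
exists f; split=> //; split=> //; last exact: raddfD.
by exists (fun t => cquot_scale nrm t piE).
Qed.
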